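(* Let $\mathsf{C}$ be a Markov category. The following hold for all objects and morphisms of the indicated types: (a) If $f:A_1\to X_1\otimes W_1\otimes Y_1$ displays $X_1\perp Y_1\,|\,W_1\,||\,A_1$ and $g:A_2\to X_2\otimes W_2\otimes Y_2$ displays $X_2\perp Y_2\,|\,W_2\,||\,A_2$, then $f\otimes g$, with outputs reordered to $X_1\otimes X_2\otimes W_1\otimes W_2\otimes Y_1\otimes Y_2$, displays $(X_1\otimes X_2)\perp(Y_1\otimes Y_2)\,|\,(W_1\otimes W_2)\,||\,(A_1\otimes A_2)$. (b) If $f:A\to X_1\otimes V\otimes Y_1$ displays $X_1\perp Y_1\,|\,V\,||\,A$ and $g:V\to X_2\otimes W\otimes Y_2$ displays $X_2\perp Y_2\,|\,W\,||\,V$, then the composite morphism $$\big(\mathrm{id}_{X_1}\otimes((\mathrm{id}_V\otimes g)\circ\mathsf{copy}_V)\otimes\mathrm{id}_{Y_1}\big)\circ f:\ A\to X_1\otimes V\otimes X_2\otimes W\otimes Y_2\otimes Y_1$$ (with outputs reordered to $X_1\otimes X_2\otimes V\otimes W\otimes Y_2\otimes Y_1$) displays $(X_1\otimes X_2)\perp(Y_2\otimes Y_1)\,|\,(V\otimes W)\,||\,A$. (c) If $f:A\to X_1\otimes W\otimes Y_1$ displays $X_1\perp Y_1\,|\,W\,||\,A$, and $g:A\otimes X_1\to X_2$ and $h:Y_1\otimes A\to Y_2$ are arbitrary, then the composite morphism $$(g\otimes\mathrm{id}_W\otimes h)\circ(\mathrm{id}_A\otimes f\otimes\mathrm{id}_A)\circ\mathsf{copy}^{(3)}_A:\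 A\to X_2\otimes W\otimes Y_2$$ displays $X_2\perp Y_2\,|\,W\,||\,A$. (d) If $\mathsf{C}$ has conditionals and $f:A\to X\otimes V\otimes W\otimes Y$ displays $X\perp Y\,|\,(V\otimes W)\,||\,A$, then there is a conditional $f_{|V}:V\otimes A\to X\otimes W\otimes Y$ of $f$ which displays $X\perp Y\,|\,W\,||\,(V\otimes A)$.
   Context: A Markov category is a symmetric monoidal category $(\mathsf{C},\otimes,I)$ with symmetry $\mathsf{swap}_{X,Y}:X\otimes Y\to Y\otimes X$, in which every object $X$ is equipped with morphisms $\mathsf{copy}_X:X\to X\otimes X$ and $\mathsf{del}_X:X\to I$ forming a commutative comonoid (coassociative, counital, cocommutative), such that: (i) $\mathsf{del}_{X\otimes Y}$ is $\mathsf{del}_X\otimes\mathsf{del}_Y$ followed by $I\otimes I\cong I$; (ii) $\mathsf{copy}_{X\otimes Y}$ is $\mathsf{copy}_X\otimes\mathsf{copy}_Y$ followed by the canonical isomorphism $(X\otimes X)\otimes(Y\otimes Y)\cong(X\otimes Y)\otimes(X\otimes Y)$ swapping the two middle factors; (iii) $\mathsf{del}_Y\circ f=\mathsf{del}_X$ for every $f:X\to Y$. Associators and unitors are suppressed in formulas. Write $\mathsf{copy}^{(3)}_W:=(\mathsf{copy}_W\otimes\mathrm{id}_W)\circ\mathsf{copy}_W:W\to W\otimes W\otimes W$. A morphism $f:A\to X\otimes W\otimes Y$ displays the conditional independence $X\perp Y\,|\,W\,||\,A$ if there are $g:A\to W$, $h:A\otimes W\to X$ and $k:W\otimes A\to Y$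 such that $f=(h\otimes\mathrm{id}_W\otimes k)\circ(\mathrm{id}_A\otimes\mathsf{copy}^{(3)}_W\otimes\mathrm{id}_A)\circ(\mathrm{id}_A\otimes g\otimes\mathrm{id}_A)\circ\mathsf{copy}^{(3)}_A$. A conditional on $X$ of a morphism $f:A\to X\otimes Y$ is a morphism $f_{|X}:X\otimes A\to Y$ such that $f=(\mathrm{id}_X\otimes f_{|X})\circ(\mathsf{copy}_X\otimes\mathrm{id}_A)\circ(f_X\otimes\mathrm{id}_A)\circ\mathsf{copy}_A$, where $f_X:=(\mathrm{id}_X\otimes\mathsf{del}_Y)\circ f:A\to X$. A conditional on a different output factor (e.g. on $V$ in (d)) is defined by first moving that factor to the front by symmetry isomorphisms. $\mathsf{C}$ has conditionals if every morphism $f:A\to X\otimes Y$ has a conditional $f_{|X}$. *)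

(* Defs.v *)
Set Implicit Arguments.
Unset Strict Implicit.
Unset Printing Implicit Defensive.

Declare Scope markov_scope.
Delimit Scope markov_scope with markov.
Local Open Scope markov_scope.

Reserved Notation "g ∘ f" (at level 40, left associativity).
Reserved Notation "X ⊗ Y" (at level 35, right associativity).
Reserved Notation "f ⊠ g" (at level 35, right associativity).

Record Category : Type := {
  ob :> Type;
  Hom : ob -> ob -> Type;
  idm : forall X : ob, Hom X X;
  comp : forall X Y Z : ob, Hom Y Z -> Hom X Y -> Hom X Z
    where "g ∘ f" := (comp g f);
  comp_idl : forall (X Y : ob) (f : Hom X Y), idm Y ∘ f = f;
  comp_idr : forall (X Y : ob) (f : Hom X Y), f ∘ idm X = f;
  compA : forall (X Y Z T : ob) (f : Hom X Y) (g : Hom Y Z) (h : Hom Z T),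
    h ∘ (g ∘ f) = (h ∘ g) ∘ f
}.

Arguments Hom {c} X Y.
Arguments idm {c} X.
Arguments comp {c X Y Z} g f.

Notation "g ∘ f" := (comp g f) : markov_scope.

(* Not assumed strict; [⊗] on objects and [⊠] on morphisms. *)
Record SymMonCat : Type := {
  smc_cat :> Category;
  unit_ob : smc_cat;
  tens : smc_cat -> smc_cat -> smc_cat
    where "X ⊗ Y" := (tens X Y);
  tensm : forall X X' Y Y' : smc_cat,
    Hom X X' -> Hom Y Y' -> Hom (X ⊗ Y) (X' ⊗ Y')
    where "f ⊠ g" := (tensm f g);
  tensm_id : forall X Y : smc_cat, idm X ⊠ idm Y = idm (X ⊗ Y);
  tensm_comp : forall (X X' X'' Y Y' Y'' : smc_cat)
    (f : Hom X X') (f' : Hom X' X'') (g : Hom Y Y') (g' : Hom Y' Y''),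
    (f' ∘ f) ⊠ (g' ∘ g) = (f' ⊠ g') ∘ (f ⊠ g);

  assoc : forall X Y Z : smc_cat, Hom ((X ⊗ Y) ⊗ Z) (X ⊗ (Y ⊗ Z));
  assoc_inv : forall X Y Z : smc_cat, Hom (X ⊗ (Y ⊗ Z)) ((X ⊗ Y) ⊗ Z);
  assocK : forall X Y Z : smc_cat,
    assoc_inv X Y Z ∘ assoc X Y Z = idm ((X ⊗ Y) ⊗ Z);
  assoc_invK : forall X Y Z : smc_cat,
    assoc X Y Z ∘ assoc_inv X Y Z = idm (X ⊗ (Y ⊗ Z));
  assoc_nat : forall (X X' Y Y' Z Z' : smc_cat)
    (f : Hom X X') (g : Hom Y Y') (h : Hom Z Z'),
    assoc X' Y' Z' ∘ ((f ⊠ g) ⊠ h) = (f ⊠ (g ⊠ h)) ∘ assoc X Y Z;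

  lunit : forall X : smc_cat, Hom (unit_ob ⊗ X) X;
  lunit_inv : forall X : smc_cat, Hom X (unit_ob ⊗ X);
  lunitK : forall X : smc_cat, lunit_inv X ∘ lunit X = idm (unit_ob ⊗ X);
  lunit_invK : forall X : smc_cat, lunit X ∘ lunit_inv X = idm X;
  lunit_nat : forall (X Y : smc_cat) (f : Hom X Y),
    lunit Y ∘ (idm unit_ob ⊠ f) = f ∘ lunit X;

  runit : forall X : smc_cat, Hom (X ⊗ unit_ob) X;
  runit_inv : forall X : smc_cat, Hom X (X ⊗ unit_ob);
  runitK : forall X : smc_cat, runit_inv X ∘ runit X = idm (X ⊗ unit_ob);
  runit_invK : forall X : smc_cat, runit X ∘ runit_inv X = idm X;
  runit_nat : forall (X Y : smc_cat) (f : Hom X Y),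
    runit Y ∘ (f ⊠ idm unit_ob) = f ∘ runit X;

  pentagon : forall W X Y Z : smc_cat,
    assoc W X (Y ⊗ Z) ∘ assoc (W ⊗ X) Y Z =
    (idm W ⊠ assoc X Y Z) ∘ assoc W (X ⊗ Y) Z ∘ (assoc W X Y ⊠ idm Z);
  triangle : forall X Y : smc_cat,
    (idm X ⊠ lunit Y) ∘ assoc X unit_ob Y = runit X ⊠ idm Y;

  swap : forall X Y : smc_cat, Hom (X ⊗ Y) (Y ⊗ X);
  swapK : forall X Y : smc_cat, swap Y X ∘ swap X Y = idm (X ⊗ Y);
  swap_nat : forall (X X' Y Y' : smc_cat) (f : Hom X X') (g : Hom Y Y'),
    swap X' Y' ∘ (f ⊠ g) = (g ⊠ f) ∘ swap X Y;
  hexagon : forall X Y Z : smc_cat,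
    assoc Y Z X ∘ swap X (Y ⊗ Z) ∘ assoc X Y Z =
    (idm Y ⊠ swap X Z) ∘ assoc Y X Z ∘ (swap X Y ⊠ idm Z)
}.

Arguments unit_ob {s}.
Arguments tens {s} X Y.
Arguments tensm {s X X' Y Y'} f g.
Arguments assoc {s} X Y Z.
Arguments assoc_inv {s} X Y Z.
Arguments lunit {s} X.
Arguments lunit_inv {s} X.
Arguments runit {s} X.
Arguments runit_inv {s} X.
Arguments swap {s} X Y.

Notation "X ⊗ Y" := (tens X Y) : markov_scope.
Notation "f ⊠ g" := (tensm f g) : markov_scope.

(* X ⊗ Y ⊗ Z ≅ Y ⊗ X ⊗ Z *)
Definition to_front (C : SymMonCat) (X Y Z : C) :
    Hom (X ⊗ (Y ⊗ Z)) (Y ⊗ (X ⊗ Z)) :=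
  assoc Y X Z ∘ (swap X Y ⊠ idm Z) ∘ assoc_inv X Y Z.

(* X ⊗ Y ⊗ Z ⊗ T ≅ X ⊗ Z ⊗ Y ⊗ T *)
Definition swap_middle (C : SymMonCat) (X Y Z T : C) :
    Hom ((X ⊗ Y) ⊗ (Z ⊗ T)) ((X ⊗ Z) ⊗ (Y ⊗ T)) :=
  assoc_inv X Z (Y ⊗ T) ∘ (idm X ⊠ to_front Y Z T) ∘ assoc X Y (Z ⊗ T).

Record MarkovCat : Type := {
  markov_smc :> SymMonCat;
  copy : forall X : markov_smc, Hom X (X ⊗ X);
  del : forall X : markov_smc, Hom X unit_ob;
  copy_coassoc : forall X : markov_smc,
    assoc X X X ∘ (copy X ⊠ idm X) ∘ copy X = (idm X ⊠ copy X) ∘ copy X;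
  copy_counitl : forall X : markov_smc,
    lunit X ∘ (del X ⊠ idm X) ∘ copy X = idm X;
  copy_counitr : forall X : markov_smc,
    runit X ∘ (idm X ⊠ del X) ∘ copy X = idm X;
  copy_cocomm : forall X : markov_smc, swap X X ∘ copy X = copy X;
  del_tens : forall X Y : markov_smc,
    del (X ⊗ Y) = lunit unit_ob ∘ (del X ⊠ del Y);
  copy_tens : forall X Y : markov_smc,
    copy (X ⊗ Y) = swap_middle X X Y Y ∘ (copy X ⊠ copy Y);
  del_nat : forall (X Y : markov_smc) (f : Hom X Y), del Y ∘ f = del X
}.

Arguments copy {m} X.
Arguments del {m} X.

Definition copy3 (C : MarkovCat) (W : C) : Hom W (W ⊗ W ⊗ W) :=
  assoc W W W ∘ (copy W ⊠ idm W) ∘ copy W.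

(* Pure rebracketing of A ⊗ X ⊗ W ⊗ Y ⊗ B. *)
Definition rebracket (C : SymMonCat) (A X W Y B : C) :
    Hom (A ⊗ ((X ⊗ W ⊗ Y) ⊗ B)) ((A ⊗ X) ⊗ (W ⊗ (Y ⊗ B))) :=
  (idm (A ⊗ X) ⊠ assoc W Y B)
    ∘ assoc_inv A X ((W ⊗ Y) ⊗ B)
    ∘ (idm A ⊠ assoc X (W ⊗ Y) B).

(* [displays X Y W A f]: f displays X ⊥ Y | W || A. *)
Definition displays (C : MarkovCat) (X Y W A : C)
    (f : Hom A (X ⊗ W ⊗ Y)) : Prop :=
  exists (g : Hom A W) (h : Hom (A ⊗ W) X) (k : Hom (W ⊗ A) Y),
    f = (h ⊠ (idm W ⊠ k))
          ∘ rebracket A W W W A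
          ∘ (idm A ⊠ (copy3 W ⊠ idm A))
          ∘ (idm A ⊠ (g ⊠ idm A))
          ∘ copy3 A.

Arguments displays {C} X Y W A f.

Definition marginal (C : MarkovCat) (A X Y : C) (f : Hom A (X ⊗ Y)) :
    Hom A X :=
  runit X ∘ (idm X ⊠ del Y) ∘ f.

Definition is_conditional (C : MarkovCat) (A X Y : C)
    (f : Hom A (X ⊗ Y)) (c : Hom (X ⊗ A) Y) : Prop :=
  f = (idm X ⊠ c)
        ∘ assoc X X A
        ∘ (copy X ⊠ idm A)
        ∘ (marginal f ⊠ idm A)
        ∘ copy A.

Definition has_conditionals (C : MarkovCat) : Prop :=
  forall (A X Y : C) (f : Hom A (X ⊗ Y)),
    exists c : Hom (X ⊗ A) Y, is_conditional f c.

(* Reorders (X1 ⊗ W1 ⊗ Y1) ⊗ (X2 ⊗ W2 ⊗ Y2) by grouping like factors. *)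
Definition reorder_parallel (C : SymMonCat) (X1 W1 Y1 X2 W2 Y2 : C) :
    Hom ((X1 ⊗ W1 ⊗ Y1) ⊗ (X2 ⊗ W2 ⊗ Y2))
        ((X1 ⊗ X2) ⊗ (W1 ⊗ W2) ⊗ (Y1 ⊗ Y2)) :=
  (idm (X1 ⊗ X2) ⊠ swap_middle W1 Y1 W2 Y2)
    ∘ swap_middle X1 (W1 ⊗ Y1) X2 (W2 ⊗ Y2).

(* Exchanges V and X2 in X1 ⊗ V ⊗ X2 ⊗ W ⊗ Y2 ⊗ Y1; all else is rebracketing. *)
Definition reorder_sequential (C : SymMonCat) (X1 V X2 W Y2 Y1 : C) :
    Hom (X1 ⊗ ((V ⊗ (X2 ⊗ W ⊗ Y2)) ⊗ Y1))
        ((X1 ⊗ X2) ⊗ (V ⊗ W) ⊗ (Y2 ⊗ Y1)) :=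
  assoc_inv X1 X2 ((V ⊗ W) ⊗ (Y2 ⊗ Y1))
    ∘ (idm X1 ⊠ (idm X2 ⊠ (assoc (V ⊗ W) Y2 Y1 ∘ (assoc_inv V W Y2 ⊠ idm Y1))))
    ∘ (idm X1 ⊠ assoc X2 (V ⊗ (W ⊗ Y2)) Y1)
    ∘ (idm X1 ⊠ (to_front V X2 (W ⊗ Y2) ⊠ idm Y1)).

(* Main.v *)
From Corelib Require Import ssreflect.
Require Import Defs.
Local Open Scope markov_scope.

(* Deterministic morphisms form a cartesian subcategory containing all structure
   maps, so coherence is checked on projections. Up to a deterministic map, every
   string diagram is a succession of steps [X -> X ⊗ Y] that sample a new variable
   and keep the old ones ([⟨idm X, g⟩]), and such steps can be hoisted out of
   pairings. In this form a morphism displays the conditional independence iff it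
   is [⟨h, ⟨sndm, k⟩⟩ ∘ ⟨idm, g⟩], and each part exhibits the new [g], [h], [k]; in
   (d), a conditional [c] of [g : A -> V ⊗ W] on [V] provides the sampling map of
   the conditional of [f]. *)

Set Implicit Arguments.
Unset Strict Implicit.

(** * Coherence and naturality in a symmetric monoidal category *)

Section SymmetricMonoidal.
Context {C : SymMonCat}.
Implicit Types X Y Z T : C.

Lemma tensm_compl X X' X'' Y Y' (f : Hom X X') (f' : Hom X' X'') (g : Hom Y Y') :
  (f' ∘ f) ⊠ g = (f' ⊠ idm Y') ∘ (f ⊠ g).
Proof. by rewrite -tensm_comp comp_idl. Qed.

Lemma tensm_compr X X' Y Y' Y'' (f : Hom X X') (g : Hom Y Y') (g' : Hom Y' Y'') :
  f ⊠ (g' ∘ g) = (idm X' ⊠ g') ∘ (f ⊠ g).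
Proof. by rewrite -tensm_comp comp_idl. Qed.

Lemma assoc_inv_nat X X' Y Y' Z Z' (f : Hom X X') (g : Hom Y Y') (h : Hom Z Z') :
  assoc_inv X' Y' Z' ∘ (f ⊠ (g ⊠ h)) = ((f ⊠ g) ⊠ h) ∘ assoc_inv X Y Z.
Proof.
rewrite -[LHS]comp_idr -(assoc_invK X Y Z) compA -(compA (assoc X Y Z)) -assoc_nat.
by rewrite !compA assocK comp_idl.
Qed.

Lemma assoc_epi X Y Z T (f g : Hom (X ⊗ (Y ⊗ Z)) T) :
  f ∘ assoc X Y Z = g ∘ assoc X Y Z -> f = g.
Proof.
move=> e; rewrite -[f]comp_idr -[g]comp_idr -assoc_invK !compA.
by rewrite e.
Qed.

Lemma assoc_mono X Y Z T (f g : Hom T ((X ⊗ Y) ⊗ Z)) :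
  assoc X Y Z ∘ f = assoc X Y Z ∘ g -> f = g.
Proof.
move=> e; rewrite -[f]comp_idl -[g]comp_idl -assocK -!compA.
by rewrite e.
Qed.

Lemma tens_unitl_faithful X Y (f g : Hom X Y) :
  idm unit_ob ⊠ f = idm unit_ob ⊠ g -> f = g.
Proof.
move=> e; rewrite -[f]comp_idr -[g]comp_idr -lunit_invK !compA -!lunit_nat.
by rewrite e.
Qed.

Lemma tens_unitr_faithful X Y (f g : Hom X Y) :
  f ⊠ idm unit_ob = g ⊠ idm unit_ob -> f = g.
Proof.
move=> e; rewrite -[f]comp_idr -[g]comp_idr -runit_invK !compA -!runit_nat.
by rewrite e.
Qed.

(** Kelly's argument: tensoring with the unit is faithful and associators are invertible, so it
    suffices to compare the two sides inside a pentagon, where the triangle identity settles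
    them. *)
Lemma lunit_tens X Y :
  lunit (X ⊗ Y) ∘ assoc unit_ob X Y = lunit X ⊠ idm Y.
Proof.
apply: tens_unitl_faithful; apply: assoc_epi.
have e : assoc (s:=C) unit_ob unit_ob X ⊠ idm Y ∘ (assoc_inv unit_ob unit_ob X ⊠ idm Y)
    = idm _.
  by rewrite -tensm_compl assoc_invK tensm_id.
rewrite -[LHS]comp_idr -[RHS]comp_idr -e !compA; congr (_ ∘ _).
rewrite tensm_compr -!compA (compA _ _ (idm unit_ob ⊠ assoc _ _ _)) -pentagon.
rewrite !compA triangle -assoc_nat -!compA.
by rewrite -tensm_compl triangle -tensm_id assoc_nat.
Qed.

Lemma runit_tens X Y :
  (idm X ⊠ runit Y) ∘ assoc X Y unit_ob = runit (X ⊗ Y).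
Proof.
apply: tens_unitr_faithful; apply: assoc_mono.
rewrite tensm_compl compA assoc_nat -(triangle Y) tensm_compr.
rewrite -!compA (compA _ _ (idm X ⊠ assoc _ _ _)) -pentagon.
by rewrite !compA -assoc_nat -compA tensm_id triangle.
Qed.

Lemma to_front_nat X X' Y Y' Z Z' (f : Hom X X') (g : Hom Y Y') (h : Hom Z Z') :
  to_front X' Y' Z' ∘ (f ⊠ (g ⊠ h)) = (g ⊠ (f ⊠ h)) ∘ to_front X Y Z.
Proof.
rewrite /to_front -compA assoc_inv_nat compA -(compA ((f ⊠ g) ⊠ h)).
by rewrite -tensm_comp swap_nat comp_idl -[h in LHS]comp_idr tensm_comp !compA assoc_nat.
Qed.

Lemma swap_middle_nat X X' Y Y' Z Z' T T'
    (f : Hom X X') (g : Hom Y Y') (h : Hom Z Z') (k : Hom T T') :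
  swap_middle X' Y' Z' T' ∘ ((f ⊠ g) ⊠ (h ⊠ k))
  = ((f ⊠ h) ⊠ (g ⊠ k)) ∘ swap_middle X Y Z T.
Proof.
rewrite /swap_middle -compA assoc_nat compA -(compA (f ⊠ _)).
rewrite -tensm_comp comp_idl to_front_nat -[f in LHS]comp_idr tensm_comp.
by rewrite !compA assoc_inv_nat.
Qed.

End SymmetricMonoidal.

(** * Pairings and projections in a Markov category *)

Section Pairing.
Context {C : MarkovCat}.
Implicit Types X Y Z T : C.

(* Locked, so that rewriting with [compA] does not look inside. *)
Fact pairing_key : unit. Proof. exact: tt. Qed.
Definition pairm X Y Z (f : Hom Z X) (g : Hom Z Y) : Hom Z (X ⊗ Y) :=
  locked_with pairing_key ((f ⊠ g) ∘ copy Z).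
Definition fstm X Y : Hom (X ⊗ Y) X :=
  locked_with pairing_key (runit X ∘ (idm X ⊠ del Y)).
Definition sndm X Y : Hom (X ⊗ Y) Y :=
  locked_with pairing_key (lunit Y ∘ (del X ⊠ idm Y)).

Lemma pairmE X Y Z (f : Hom Z X) (g : Hom Z Y) : pairm f g = (f ⊠ g) ∘ copy Z.
Proof. by rewrite [LHS]unlock. Qed.
Lemma fstmE X Y : fstm X Y = runit X ∘ (idm X ⊠ del Y).
Proof. by rewrite [LHS]unlock. Qed.
Lemma sndmE X Y : sndm X Y = lunit Y ∘ (del X ⊠ idm Y).
Proof. by rewrite [LHS]unlock. Qed.

Local Notation "⟨ f , g ⟩" := (pairm f g).

Lemma tensm_pair X X' Y Y' Z (f : Hom Z X) (g : Hom Z Y)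
    (f' : Hom X X') (g' : Hom Y Y') :
  (f' ⊠ g') ∘ ⟨f, g⟩ = ⟨f' ∘ f, g' ∘ g⟩.
Proof. by rewrite !pairmE compA -tensm_comp. Qed.

Lemma fst_nat X X' Y Y' (f : Hom X X') (g : Hom Y Y') :
  fstm X' Y' ∘ (f ⊠ g) = f ∘ fstm X Y.
Proof.
rewrite !fstmE -compA -tensm_comp del_nat comp_idl -[f in LHS]comp_idr.
by rewrite tensm_compl compA runit_nat -compA.
Qed.

Lemma snd_nat X X' Y Y' (f : Hom X X') (g : Hom Y Y') :
  sndm X' Y' ∘ (f ⊠ g) = g ∘ sndm X Y.
Proof.
rewrite !sndmE -compA -tensm_comp del_nat comp_idl -[g in LHS]comp_idr.
by rewrite tensm_compr compA lunit_nat -compA.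
Qed.

Lemma fst_pair X Y Z (f : Hom Z X) (g : Hom Z Y) : fstm X Y ∘ ⟨f, g⟩ = f.
Proof. by rewrite !pairmE compA fst_nat -compA fstmE copy_counitr comp_idr. Qed.

Lemma snd_pair X Y Z (f : Hom Z X) (g : Hom Z Y) : sndm X Y ∘ ⟨f, g⟩ = g.
Proof. by rewrite !pairmE compA snd_nat -compA sndmE copy_counitl comp_idr. Qed.

Lemma swap_pair X Y Z (f : Hom Z X) (g : Hom Z Y) : swap X Y ∘ ⟨f, g⟩ = ⟨g, f⟩.
Proof. by rewrite !pairmE compA swap_nat -compA copy_cocomm. Qed.

Lemma assoc_pair X Y Z T (f : Hom T X) (g : Hom T Y) (h : Hom T Z) :
  assoc X Y Z ∘ ⟨⟨f, g⟩, h⟩ = ⟨f, ⟨g, h⟩⟩.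
Proof.
rewrite !pairmE -[h in LHS]comp_idr tensm_comp !compA assoc_nat.
rewrite -2!compA (compA (copy T)) copy_coassoc compA -tensm_comp.
by rewrite comp_idr.
Qed.

Lemma assoc_inv_pair X Y Z T (f : Hom T X) (g : Hom T Y) (h : Hom T Z) :
  assoc_inv X Y Z ∘ ⟨f, ⟨g, h⟩⟩ = ⟨⟨f, g⟩, h⟩.
Proof. by rewrite -assoc_pair compA assocK comp_idl. Qed.

Lemma to_front_pair X Y Z T (f : Hom T X) (g : Hom T Y) (h : Hom T Z) :
  to_front X Y Z ∘ ⟨f, ⟨g, h⟩⟩ = ⟨g, ⟨f, h⟩⟩.
Proof.
by rewrite /to_front -!compA assoc_inv_pair tensm_pair swap_pair comp_idl assoc_pair.
Qed.

Lemma swap_middle_pair W X Y Z T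
    (f : Hom W X) (g : Hom W Y) (h : Hom W Z) (k : Hom W T) :
  swap_middle X Y Z T ∘ ⟨⟨f, g⟩, ⟨h, k⟩⟩ = ⟨⟨f, h⟩, ⟨g, k⟩⟩.
Proof.
rewrite /swap_middle -!compA assoc_pair tensm_pair to_front_pair.
by rewrite comp_idl assoc_inv_pair.
Qed.

(* Naturality of [del] alone makes [del unit_ob] merely idempotent; the counit law
   and [del_tens] are needed to make [unit_ob] terminal. *)
Lemma del_unit : del (unit_ob : C) = idm unit_ob.
Proof.
set e := del unit_ob.
have eE : runit_inv unit_ob = (idm unit_ob ⊠ e) ∘ copy (unit_ob : C).
  have := f_equal (comp (runit_inv _)) (copy_counitr (unit_ob : C)).
  by rewrite !compA runitK comp_idl comp_idr.
have ee : e ⊠ e = idm unit_ob ⊠ e.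
  rewrite -[LHS]comp_idl -[RHS]comp_idl -lunitK -!compA; congr (_ ∘ _).
  by rewrite -del_tens lunit_nat del_nat.
have h : (e ⊠ idm unit_ob) ∘ runit_inv unit_ob = runit_inv unit_ob.
  by rewrite eE compA -tensm_comp comp_idr comp_idl ee.
by rewrite -[LHS]comp_idr -runit_invK compA -runit_nat -compA h.
Qed.

(** The unit is terminal by [del_unit], so both sides agree after composition with the isomorphism
    [lunit unit_ob]. *)
Lemma swap_unit : swap unit_ob unit_ob = idm ((unit_ob : C) ⊗ unit_ob).
Proof.
rewrite -[LHS]comp_idl -[RHS]comp_idl -lunitK -!compA; congr (_ ∘ _).
have lE : lunit unit_ob = del ((unit_ob : C) ⊗ unit_ob).
  by rewrite del_tens del_unit tensm_id comp_idr.
by rewrite lE !del_nat.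
Qed.

(** By [copy_tens] and naturality, the deletions move before the middle swap, which then exchanges
    two units and is trivial by [swap_unit]; the counit laws remain. *)
Lemma pair_fst_snd X Y : ⟨fstm X Y, sndm X Y⟩ = idm (X ⊗ Y).
Proof.
rewrite pairmE fstmE sndmE tensm_comp copy_tens compA -(compA (swap_middle _ _ _ _)).
rewrite -swap_middle_nat /swap_middle /to_front swap_unit tensm_id comp_idr.
rewrite assoc_invK tensm_id comp_idr assocK comp_idl -!tensm_comp.
by rewrite copy_counitl copy_counitr tensm_id.
Qed.

Lemma fst_swap X Y : fstm Y X ∘ swap X Y = sndm X Y.
Proof. by rewrite -[LHS]comp_idr -pair_fst_snd -compA swap_pair fst_pair. Qed.

Lemma snd_swap X Y : sndm Y X ∘ swap X Y = fstm X Y.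
Proof. by rewrite -[LHS]comp_idr -pair_fst_snd -compA swap_pair snd_pair. Qed.

(** This and the next lemmas rest on unitor coherence: splitting the identity of a threefold product
    into projections would require projections to be deterministic, which is derived from these
    lemmas. *)
Lemma snd_assoc X Y Z : sndm X (Y ⊗ Z) ∘ assoc X Y Z = sndm X Y ⊠ idm Z.
Proof.
rewrite !sndmE -tensm_id -compA -assoc_nat compA lunit_tens.
by rewrite -tensm_comp comp_idl.
Qed.

Lemma fst_assoc X Y Z : (idm X ⊠ fstm Y Z) ∘ assoc X Y Z = fstm (X ⊗ Y) Z.
Proof.
rewrite !fstmE -tensm_id tensm_compr -compA -assoc_nat compA runit_tens.
by rewrite tensm_id.
Qed.

Lemma middle_assoc X Y Z : (idm X ⊠ sndm Y Z) ∘ assoc X Y Z = fstm X Y ⊠ idm Z.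
Proof.
rewrite !fstmE !sndmE tensm_compr -compA -assoc_nat compA triangle.
by rewrite -tensm_comp comp_idl.
Qed.

Lemma assoc_invE X Y Z T (f : Hom (X ⊗ (Y ⊗ Z)) T) (g : Hom ((X ⊗ Y) ⊗ Z) T) :
  f ∘ assoc X Y Z = g -> g ∘ assoc_inv X Y Z = f.
Proof. by move=> <-; rewrite -compA assoc_invK comp_idr. Qed.

Lemma snd_to_front X Y Z : sndm Y (X ⊗ Z) ∘ to_front X Y Z = idm X ⊠ sndm Y Z.
Proof.
rewrite /to_front !compA snd_assoc -tensm_comp snd_swap comp_idl.
exact: assoc_invE (middle_assoc _ _ _).
Qed.

Lemma to_front_snd X Y Z : (idm Y ⊠ sndm X Z) ∘ to_front X Y Z = sndm X (Y ⊗ Z).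
Proof.
rewrite /to_front !compA middle_assoc -tensm_comp fst_swap comp_idl.
exact: assoc_invE (snd_assoc _ _ _).
Qed.

(** For [det_fst]: with [copy_tens] it turns [(fstm X Y ⊠ fstm X Y) ∘ copy (X ⊗ Y)] into
    [fstm _ _ ∘ (copy X ⊠ copy Y)], to which [fst_nat] applies. *)
Lemma swap_middle_fst X Y Z T :
  (fstm X Z ⊠ fstm Y T) ∘ swap_middle X Y Z T = fstm (X ⊗ Y) (Z ⊗ T).
Proof.
have -> : fstm X Z ⊠ fstm Y T = (idm X ⊠ fstm Y T) ∘ (fstm X Z ⊠ idm _).
  by rewrite -tensm_comp comp_idl comp_idr.
rewrite /swap_middle !compA -(compA (assoc_inv _ _ _)) (assoc_invE (middle_assoc _ _ _)).
rewrite -!tensm_compr -(compA (to_front _ _ _)) snd_to_front fst_nat comp_idl.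
exact: fst_assoc.
Qed.

Lemma swap_middle_snd X Y Z T :
  (sndm X Z ⊠ sndm Y T) ∘ swap_middle X Y Z T = sndm (X ⊗ Y) (Z ⊗ T).
Proof.
have -> : sndm X Z ⊠ sndm Y T = (sndm X Z ⊠ idm _) ∘ (idm _ ⊠ sndm Y T).
  by rewrite -tensm_comp comp_idl comp_idr.
rewrite /swap_middle !compA -(compA (assoc_inv _ _ _)) -tensm_id -assoc_inv_nat.
rewrite compA (assoc_invE (snd_assoc _ _ _)) -compA -compA (compA (assoc _ _ _)).
rewrite -tensm_compr to_front_snd compA snd_nat -compA snd_assoc snd_nat.
by rewrite comp_idl.
Qed.

(** * Deterministic morphisms *)

Class det X Y (d : Hom X Y) : Prop := copy_nat : copy Y ∘ d = ⟨d, d⟩.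

Instance det_id X : det (idm X).
Proof. by rewrite /det !pairmE tensm_id comp_idl comp_idr. Qed.

(** The right side runs [d] twice, which is harmless only when [d] commutes with copying. Instance
    resolution supplies this for structure maps. *)
Lemma pair_comp X Y Z T (f : Hom Z X) (g : Hom Z Y) (d : Hom T Z) {dd : det d} :
  ⟨f, g⟩ ∘ d = ⟨f ∘ d, g ∘ d⟩.
Proof. by rewrite pairmE -compA copy_nat tensm_pair. Qed.

Instance det_comp X Y Z (g : Hom Y Z) (f : Hom X Y) {dg : det g} {df : det f} :
  det (g ∘ f).
Proof. by rewrite /det compA copy_nat pair_comp. Qed.

Instance det_fst X Y : det (fstm X Y).
Proof.
by rewrite /det -(fst_nat (copy X) (copy Y)) !pairmE copy_tens compA swap_middle_fst.
Qed.

Instance det_snd X Y : det (sndm X Y).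
Proof.
by rewrite /det -(snd_nat (copy X) (copy Y)) !pairmE copy_tens compA swap_middle_snd.
Qed.

Instance det_pair X Y Z (f : Hom Z X) (g : Hom Z Y) {df : det f} {dg : det g} :
  det ⟨f, g⟩.
Proof.
by rewrite /det copy_tens -compA tensm_pair !copy_nat swap_middle_pair.
Qed.

Lemma pair_eta X Y Z (f : Hom Z (X ⊗ Y)) {df : det f} :
  ⟨fstm X Y ∘ f, sndm X Y ∘ f⟩ = f.
Proof. by rewrite -pair_comp pair_fst_snd comp_idl. Qed.

Lemma tensmE X X' Y Y' (f : Hom X X') (g : Hom Y Y') :
  f ⊠ g = ⟨f ∘ fstm X Y, g ∘ sndm X Y⟩.
Proof. by rewrite -tensm_pair pair_fst_snd comp_idr. Qed.

Lemma assocE X Y Z :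
  assoc X Y Z = ⟨fstm X Y ∘ fstm _ Z, ⟨sndm X Y ∘ fstm _ Z, sndm _ Z⟩⟩.
Proof. by rewrite -assoc_pair pair_eta pair_fst_snd comp_idr. Qed.

Lemma swapE X Y : swap X Y = ⟨sndm X Y, fstm X Y⟩.
Proof. by rewrite -swap_pair pair_fst_snd comp_idr. Qed.

Lemma swap_middleE X Y Z T :
  swap_middle X Y Z T
  = ⟨⟨fstm X Y ∘ fstm _ _, fstm Z T ∘ sndm _ _⟩,
     ⟨sndm X Y ∘ fstm _ _, sndm Z T ∘ sndm _ _⟩⟩.
Proof. by rewrite -swap_middle_pair !pair_eta pair_fst_snd comp_idr. Qed.

Instance det_swap X Y : det (swap X Y).
Proof. rewrite swapE; exact: _. Qed.

Instance det_swap_middle X Y Z T : det (swap_middle X Y Z T).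
Proof. rewrite swap_middleE; exact: _. Qed.

Lemma swap_middleK X Y Z T : swap_middle X Z Y T ∘ swap_middle X Y Z T = idm _.
Proof. by rewrite (swap_middleE X Y Z T) swap_middle_pair !pair_eta pair_fst_snd. Qed.

(** Since [copy_tens] handles the copying, no determinism is assumed: this is how two independent
    sampling steps merge into one. *)
Lemma swap_middle_tensm X X' Y Y' Z T
    (f : Hom Z X) (g : Hom Z Y) (f' : Hom T X') (g' : Hom T Y') :
  swap_middle X Y X' Y' ∘ (⟨f, g⟩ ⊠ ⟨f', g'⟩) = ⟨f ⊠ f', g ⊠ g'⟩.
Proof.
by rewrite !pairmE tensm_comp compA swap_middle_nat -compA -copy_tens.
Qed.

Lemma copyE X : copy X = ⟨idm X, idm X⟩.
Proof. by rewrite !pairmE tensm_id comp_idl. Qed.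

(** * Sampling steps and the normal form of conditional independence *)

Local Notation extend f := (pairm (idm _) f).

Lemma pair_fst X Y Z (h : Hom (X ⊗ Y) Z) :
  ⟨fstm X Y, h⟩ = (idm X ⊠ h) ∘ assoc X X Y ∘ (copy X ⊠ idm Y).
Proof.
rewrite -compA (tensmE (copy X)) comp_idl copy_nat assoc_pair pair_fst_snd.
by rewrite tensm_pair comp_idl comp_idr.
Qed.

(** Coassociativity lets [g] be sampled before the pairing: [f] ignores the new variable, and [g]
    still runs only once, so it may be random. *)
Lemma pair_extendl X Y Z T (g : Hom X Y) (f : Hom X Z) (h : Hom (X ⊗ Y) T) :
  ⟨f, h ∘ extend g⟩ = ⟨f ∘ fstm X Y, h⟩ ∘ extend g.
Proof.
rewrite -[h in RHS]comp_idl -tensm_pair pair_fst -!compA tensm_pair comp_idr comp_idl.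
by rewrite copyE assoc_pair !tensm_pair !comp_idl comp_idr.
Qed.

Lemma pair_extendr X Y Z T (g : Hom X Y) (f : Hom X Z) (h : Hom (X ⊗ Y) T) :
  ⟨h ∘ extend g, f⟩ = ⟨h, f ∘ fstm X Y⟩ ∘ extend g.
Proof. by rewrite -swap_pair pair_extendl compA swap_pair. Qed.

Lemma swap_extend X Y (g : Hom X Y) : swap X Y ∘ extend g = ⟨g, idm X⟩.
Proof. exact: swap_pair. Qed.

Lemma pair_coextendl X Y Z T (g : Hom X Y) (f : Hom X Z) (h : Hom (Y ⊗ X) T) :
  ⟨f, h ∘ ⟨g, idm X⟩⟩ = ⟨f ∘ sndm Y X, h⟩ ∘ ⟨g, idm X⟩.
Proof.
by rewrite -!swap_extend !compA pair_extendl pair_comp -compA snd_swap.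
Qed.

Lemma copy3E X : copy3 X = ⟨idm X, ⟨idm X, idm X⟩⟩.
Proof.
by rewrite /copy3 -compA copyE tensm_pair comp_idl comp_idr assoc_pair.
Qed.

Lemma rebracket_pair A X W Y B T (a : Hom T A) (x : Hom T X) (w : Hom T W)
    (y : Hom T Y) (b : Hom T B) :
  rebracket A X W Y B ∘ ⟨a, ⟨⟨x, ⟨w, y⟩⟩, b⟩⟩ = ⟨⟨a, x⟩, ⟨w, ⟨y, b⟩⟩⟩.
Proof.
rewrite /rebracket -!compA tensm_pair assoc_pair assoc_inv_pair.
by rewrite tensm_pair assoc_pair !comp_idl.
Qed.

Lemma copy3_pair A X (f : Hom A X) :
  (idm A ⊠ (f ⊠ idm A)) ∘ copy3 A = ⟨idm A, ⟨f, idm A⟩⟩.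
Proof. by rewrite copy3E !tensm_pair !comp_idl comp_idr. Qed.

Lemma copy3_extend A W X (g : Hom A W) (f : Hom (A ⊗ W) X) :
  (idm A ⊠ ((f ∘ extend g) ⊠ idm A)) ∘ copy3 A = ⟨fstm A W, ⟨f, fstm A W⟩⟩ ∘ extend g.
Proof. by rewrite copy3_pair pair_extendr pair_extendl !comp_idl. Qed.

Lemma displaysP X Y W A (f : Hom A (X ⊗ (W ⊗ Y))) :
  displays X Y W A f <->
  exists (g : Hom A W) (h : Hom (A ⊗ W) X) (k : Hom (A ⊗ W) Y),
    f = ⟨h, ⟨sndm A W, k⟩⟩ ∘ extend g.
Proof.
have canon (g : Hom A W) (h : Hom (A ⊗ W) X) (k : Hom (W ⊗ A) Y) :
    (h ⊠ (idm W ⊠ k)) ∘ rebracket A W W W A ∘ (idm A ⊠ (copy3 W ⊠ idm A))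
      ∘ (idm A ⊠ (g ⊠ idm A)) ∘ copy3 A
    = ⟨h, ⟨sndm A W, k ∘ swap A W⟩⟩ ∘ extend g.
  (* Writing [g] as a projection of [extend g] allows the sampling to be hoisted; what remains
     before [h] and [k] is deterministic. *)
  rewrite -[g in LHS](snd_pair (idm A)) -compA copy3_extend compA; congr (_ ∘ _).
  rewrite -2!compA tensm_pair comp_idl tensm_pair comp_idl copy3E !pair_comp comp_idl.
  by rewrite rebracket_pair !tensm_pair comp_idl pair_fst_snd comp_idr swapE.
split=> [[g [h [k ->]]] | [g [h [k ->]]]].
  by exists g, h, (k ∘ swap A W); exact: canon.
by exists g, h, (k ∘ swap W A); rewrite canon -compA swapK comp_idr.
Qed.

(** * Closure under tensor, composition, postprocessing and conditioning *)

Lemma displays_tensm A1 X1 W1 Y1 A2 X2 W2 Y2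
    (f : Hom A1 (X1 ⊗ W1 ⊗ Y1)) (g : Hom A2 (X2 ⊗ W2 ⊗ Y2)) :
  displays X1 Y1 W1 A1 f -> displays X2 Y2 W2 A2 g ->
  displays (X1 ⊗ X2) (Y1 ⊗ Y2) (W1 ⊗ W2) (A1 ⊗ A2)
    (reorder_parallel X1 W1 Y1 X2 W2 Y2 ∘ (f ⊠ g)).
Proof.
move=> /displaysP [g1 [h1 [k1 ->]]] /displaysP [g2 [h2 [k2 ->]]].
apply/displaysP.
(* [s] puts each input next to its own conditioning variable. Being deterministic, it factors out of
   the pairing and cancels the middle swap that merges the two sampling steps. *)
set s := swap_middle A1 A2 W1 W2.
exists (g1 ⊠ g2), ((h1 ⊠ h2) ∘ s), ((k1 ⊠ k2) ∘ s).
have sE : sndm _ _ = (sndm A1 W1 ⊠ sndm A2 W2) ∘ s by rewrite swap_middle_snd.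
rewrite sE -!pair_comp -!swap_middle_tensm -tensm_id -swap_middle_tensm.
rewrite -[RHS]compA (compA _ _ s) swap_middleK comp_idl.
rewrite tensm_comp compA; congr (_ ∘ _).
by rewrite /reorder_parallel -compA swap_middle_tensm tensm_pair comp_idl.
Qed.

Lemma reorder_sequential_pair X1 V X2 W Y2 Y1 T (x1 : Hom T X1) (v : Hom T V)
    (x2 : Hom T X2) (w : Hom T W) (y2 : Hom T Y2) (y1 : Hom T Y1) :
  reorder_sequential X1 V X2 W Y2 Y1 ∘ ⟨x1, ⟨⟨v, ⟨x2, ⟨w, y2⟩⟩⟩, y1⟩⟩
  = ⟨⟨x1, x2⟩, ⟨⟨v, w⟩, ⟨y2, y1⟩⟩⟩.
Proof.
rewrite /reorder_sequential -3!compA !tensm_pair to_front_pair assoc_pair.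
by rewrite tensm_pair -compA tensm_pair !comp_idl !assoc_inv_pair assoc_pair.
Qed.

Lemma displays_comp A X1 V Y1 X2 W Y2
    (f : Hom A (X1 ⊗ V ⊗ Y1)) (g : Hom V (X2 ⊗ W ⊗ Y2)) :
  displays X1 Y1 V A f -> displays X2 Y2 W V g ->
  displays (X1 ⊗ X2) (Y2 ⊗ Y1) (V ⊗ W) A
    (reorder_sequential X1 V X2 W Y2 Y1
      ∘ ((idm X1 ⊠ (((idm V ⊠ g) ∘ copy V) ⊠ idm Y1)) ∘ f)).
Proof.
move=> /displaysP [g1 [h1 [k1 ->]]] /displaysP [g2 [h2 [k2 ->]]].
apply/displaysP.
move: (reorder_sequential _ _ _ _ _ _) (@reorder_sequential_pair X1 V X2 W Y2 Y1).
move=> r rE.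
(* [V] is sampled from [A], then [W] from [V]; [h1] and [k1] read [A] and [V], while [h2] and [k2]
   read [V] and [W]. *)
exists (extend g2 ∘ g1), ⟨h1 ∘ ⟨fstm _ _, fstm _ _ ∘ sndm _ _⟩, h2 ∘ sndm _ _⟩,
  ⟨k2 ∘ sndm _ _, k1 ∘ ⟨fstm _ _, fstm _ _ ∘ sndm _ _⟩⟩.
(* Split into two successive steps, the sampling starts with [extend g1], which both sides share. *)
have -> : extend (extend g2 ∘ g1) = assoc _ _ _ ∘ extend (g2 ∘ sndm _ _) ∘ extend g1.
  rewrite -[g1 in LHS](snd_pair (idm A)) compA pair_comp comp_idl pair_extendl comp_idl.
  by rewrite -assoc_pair pair_fst_snd.
rewrite !compA; congr (_ ∘ _).
set e := extend (g2 ∘ sndm A V); set t : Hom ((A ⊗ V) ⊗ W) (V ⊗ W) := sndm A V ⊠ idm W.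
have dt : det t by rewrite /t tensmE; exact: _.
(* Discarding [A] commutes with sampling [W], which depends on [V] alone. *)
have te : extend g2 ∘ sndm A V = t ∘ e.
  by rewrite /t /e tensm_pair pair_comp comp_idr !comp_idl.
have a1 : ⟨fstm _ _, fstm _ _ ∘ sndm _ _⟩ ∘ assoc A V W = fstm (A ⊗ V) W.
  by rewrite assocE pair_comp -compA fst_pair snd_pair fst_pair pair_eta.
have da : det (assoc A V W) by rewrite assocE; exact: _.
rewrite !pair_comp -!compA a1 snd_assoc -/t.
rewrite -pairmE pair_extendl comp_idl !tensm_pair comp_idl.
rewrite -compA te compA pair_extendr pair_extendl compA.
by rewrite !pair_comp rE pair_eta comp_idl.
Qed.

Lemma displays_postcomp A X1 W Y1 X2 Y2
    (f : Hom A (X1 ⊗ W ⊗ Y1)) (g : Hom (A ⊗ X1) X2) (h : Hom (Y1 ⊗ A) Y2) :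
  displays X1 Y1 W A f ->
  displays X2 Y2 W A
    ((g ⊠ (idm W ⊠ h)) ∘ rebracket A X1 W Y1 A ∘ (idm A ⊠ (f ⊠ idm A)) ∘ copy3 A).
Proof.
move=> /displaysP [g1 [h1 [k1 ->]]]; apply/displaysP.
(* [W] is sampled as before, and the retained [A] also serves as the extra input of [g] and [h]. *)
exists g1, (g ∘ ⟨fstm _ _, h1⟩), (h ∘ ⟨k1, fstm _ _⟩).
rewrite -compA copy3_extend compA -(compA _ (rebracket _ _ _ _ _)).
by rewrite rebracket_pair !tensm_pair comp_idl.
Qed.

Lemma is_conditionalP A X Y (f : Hom A (X ⊗ Y)) (c : Hom (X ⊗ A) Y) :
  is_conditional f c <-> f = ⟨fstm X A, c⟩ ∘ ⟨fstm X Y ∘ f, idm A⟩.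
Proof.
by rewrite /is_conditional /marginal -fstmE -pair_fst -compA -pairmE.
Qed.

Lemma displays_conditional :
  has_conditionals C ->
  forall A X V W Y (f : Hom A (X ⊗ V ⊗ W ⊗ Y)),
    displays X Y (V ⊗ W) A ((idm X ⊠ assoc_inv V W Y) ∘ f) ->
    exists c : Hom (V ⊗ A) (X ⊗ W ⊗ Y),
      is_conditional (to_front X V (W ⊗ Y) ∘ f) c /\ displays X Y W (V ⊗ A) c.
Proof.
move=> cond A X V W Y f /displaysP [g [h [k fE]]].
have {fE} : to_front X V (W ⊗ Y) ∘ f
    = ⟨fstm _ _ ∘ sndm _ _, ⟨h, ⟨sndm _ _ ∘ sndm _ _, k⟩⟩⟩ ∘ extend g.
  rewrite -to_front_pair -[RHS]compA; congr (_ ∘ _).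
  have -> : f = (idm X ⊠ assoc V W Y) ∘ ((idm X ⊠ assoc_inv V W Y) ∘ f).
    by rewrite compA -tensm_compr assoc_invK tensm_id comp_idl.
  by rewrite fE compA tensm_pair comp_idl -[X in ⟨X, k⟩]pair_eta assoc_pair.
move: (to_front _ _ _ ∘ f) => {}f ->.
have [c /is_conditionalP gE] := cond _ _ _ g.
set u : Hom A (V ⊗ A) := ⟨fstm V W ∘ g, idm A⟩ in gE.
pose r : Hom ((V ⊗ A) ⊗ W) (A ⊗ (V ⊗ W)) :=
  ⟨sndm _ _ ∘ fstm _ _, ⟨fstm _ _ ∘ fstm _ _, sndm _ _⟩⟩.
(* Disintegration of [g]: [u] samples [V] from its marginal, [c] then samples [W], and [r] restores
   the order of the variables. *)
have egE : extend g = r ∘ extend c ∘ u.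
  rewrite [in LHS]gE pair_coextendl comp_idl; congr (_ ∘ _).
  by rewrite -[c in LHS](snd_pair (idm _)) !pair_extendl.
(* The old [h] and [k] are kept up to reordering by [r], so the witness is already in normal
   form. *)
exists (⟨h ∘ r, ⟨sndm _ _, k ∘ r⟩⟩ ∘ extend c); split; last first.
  by apply/displaysP; exists c, (h ∘ r), (k ∘ r).
apply/is_conditionalP.
(* The marginal of [f] on [V] is that of [g], so the sampling step in the conditional is again
   [u]. *)
rewrite (compA _ _ (fstm _ _)) fst_pair -(compA _ (sndm _ _)) snd_pair -/u.
rewrite pair_extendl egE !compA; congr (_ ∘ _ ∘ _).
by rewrite !pair_comp -!compA !snd_pair !fst_pair.
Qed.

End Pairing.

Theorem proposition12p18 (C : MarkovCat) :
  (forall (A1 X1 W1 Y1 A2 X2 W2 Y2 : C)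
      (f : Hom A1 (X1 ⊗ W1 ⊗ Y1)) (g : Hom A2 (X2 ⊗ W2 ⊗ Y2)),
    displays X1 Y1 W1 A1 f ->
    displays X2 Y2 W2 A2 g ->
    displays (X1 ⊗ X2) (Y1 ⊗ Y2) (W1 ⊗ W2) (A1 ⊗ A2)
      (reorder_parallel X1 W1 Y1 X2 W2 Y2 ∘ (f ⊠ g)))
  /\
  (forall (A X1 V Y1 X2 W Y2 : C)
      (f : Hom A (X1 ⊗ V ⊗ Y1)) (g : Hom V (X2 ⊗ W ⊗ Y2)),
    displays X1 Y1 V A f ->
    displays X2 Y2 W V g ->
    displays (X1 ⊗ X2) (Y2 ⊗ Y1) (V ⊗ W) A
      (reorder_sequential X1 V X2 W Y2 Y1
        ∘ ((idm X1 ⊠ (((idm V ⊠ g) ∘ copy V) ⊠ idm Y1)) ∘ f)))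
  /\
  (forall (A X1 W Y1 X2 Y2 : C)
      (f : Hom A (X1 ⊗ W ⊗ Y1)) (g : Hom (A ⊗ X1) X2) (h : Hom (Y1 ⊗ A) Y2),
    displays X1 Y1 W A f ->
    displays X2 Y2 W A
      ((g ⊠ (idm W ⊠ h))
        ∘ rebracket A X1 W Y1 A
        ∘ (idm A ⊠ (f ⊠ idm A))
        ∘ copy3 A))
  /\
  (has_conditionals C ->
    forall (A X V W Y : C) (f : Hom A (X ⊗ V ⊗ W ⊗ Y)),
      displays X Y (V ⊗ W) A ((idm X ⊠ assoc_inv V W Y) ∘ f) ->
      exists c : Hom (V ⊗ A) (X ⊗ W ⊗ Y),
        is_conditional (to_front X V (W ⊗ Y) ∘ f) c
        /\ displays X Y W (V ⊗ A) c).
Proof.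
split; first exact: displays_tensm.
split; first exact: displays_comp.
split; [exact: displays_postcomp | exact: displays_conditional].
Qed.
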